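(* Consider the system of equations for $\mathbf{E}(T)=(E_1(T),\dots,E_n(T))$ $$E_i(T) = A_i^e(T)\,\mathbb{V}_i^e(E_i(T)) - L_i^e(T) + \sum_{j=1}^n A_{ij}(T)\,\mathbb{V}_{ij}(E_j(T)) - \sum_{j=1}^n L_{ij}(T),\qquad i=1,\dots,n, \qquad ( * )$$ where the valuation is performed at maturity, $t=T$. If 1. $\mathbb{V}_i^e(E_i(T))=1$ for all $i$, 2. $\mathbb{V}_{ij}(E_j(T))=\mathbf{1}_{E_j(T)\ge 0}+\left(\frac{E_j(T)+\bar p_j(T)}{\bar p_j(T)}\right)^+\mathbf{1}_{E_j(T)<0}$ for all $i,j$, where $\bar p_j(T)=L_j^e(T)+\sum_i L_{ji}(T)$, then there is a one-to-one correspondence between the solutions of $( * )$ and the solutions of the map introduced by Eisenberg and Noe (2001), i.e. the clearing payment vectors $\mathbf{p}^*(T)$ satisfying $$p_i^*(T)=\min\left[A_i^e(T)+\sum_{j} L_{ji}(T)\frac{p_j^*(T)}{\bar p_j(T)},\ \bar p_i(T)\right],\qquad i=1,\dots,n.$$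
   Context: A financial system of $n$ banks has interbank credit contracts maturing at time $T$. For each bank $i$, $A_i^e(T)$ and $L_i^e(T)$ are the book values at time $T$ of its external (non-interbank) assets and liabilities. $L_{ij}(T)$ is the book value of the liability of bank $i$ towards bank $j$, and $A_{ij}(T)$ is the book value of the interbank asset of bank $i$ towards bank $j$, with $A_{ji}(T)=L_{ij}(T)$. $E_i(T)$ is the equity valuation of bank $i$; $\mathbb{V}_i^e$ and $\mathbb{V}_{ij}$ are the external and interbank valuation functions, i.e. the ratios between the valuation and the book value of, respectively, the external assets of $i$ and the interbank asset of $i$ towards $j$. $\bar p_j(T)$ is the total liability of bank $j$. $\mathbf{1}$ denotes an indicator and $(x)^+=(x+|x|)/2$. In the Eisenberg–Noe model, $p_i^*(T)$ is the total payment made by bank $i$ to its counterparties. *)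

(* Defs.v *)
From HB Require Import structures.
From mathcomp Require Import all_boot all_order all_algebra.
From mathcomp Require Import all_classical all_reals.

Set Implicit Arguments.
Unset Strict Implicit.
Unset Printing Implicit Defensive.

Import Order.TTheory GRing.Theory Num.Theory.

Local Open Scope classical_set_scope.
Local Open Scope ring_scope.

(* All quantities are taken at the maturity [T], which is left implicit.
   Vectors indexed by the banks are row vectors, hence the row index [0]
   in [E 0 i]. *)

Definition pos_part (R : realType) (x : R) : R := (x + `|x|) / 2.

Definition total_liability (R : realType) (n : nat)
    (Le : 'rV[R]_n) (L : 'M[R]_n) (j : 'I_n) : R :=
  Le 0 j + \sum_(i < n) L j i.

(* [Ve] and [V] are the external and interbank valuation functions. *)
Definition equity_solutions (R : realType) (n : nat)
    (Ae Le : 'rV[R]_n) (A L : 'M[R]_n)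
    (Ve : 'I_n -> R -> R) (V : 'I_n -> 'I_n -> R -> R) : set 'rV[R]_n :=
  [set E | forall i : 'I_n,
     E 0 i = Ae 0 i * Ve i (E 0 i) - Le 0 i
             + \sum_(j < n) A i j * V i j (E 0 j) - \sum_(j < n) L i j].

(* The interbank valuation at maturity, as a function of the equity [x] and
   the total liability [pbar] of the borrower.  For [pbar = 0] the quotient is
   [0] in MathComp; when liabilities are nonnegative, such a borrower has no
   interbank liability, so its valuation only ever multiplies a zero asset. *)
Definition en_valuation (R : realType) (pbar x : R) : R :=
  (0 <= x)%R%:R + pos_part ((x + pbar) / pbar) * (x < 0)%R%:R.

(* Fixed points of the Eisenberg-Noe map, which is defined on the box
   [0 <= p <= pbar].  The lower bound does not follow from the equations: two
   banks owing 1 to each other, with no external assets or liabilities, satisfy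
   them with [p = (c, c)] for any [c <= 1].  As in Eisenberg and Noe, the
   relative liability of a bank without liabilities is 0. *)
Definition clearing_vectors (R : realType) (n : nat)
    (Ae Le : 'rV[R]_n) (L : 'M[R]_n) : set 'rV[R]_n :=
  [set p | (forall i : 'I_n, 0 <= p 0 i <= total_liability Le L i) /\
     (forall i : 'I_n,
        p 0 i = Num.min
                  (Ae 0 i + \sum_(j < n)
                     L j i * (p 0 j / total_liability Le L j))
                  (total_liability Le L i))].

(* Main.v *)
(* A bank with equity [x] and total liability [pbar] pays [x + pbar] clipped
   between [0] and [pbar], which is [pbar] times its valuation.  The right-hand
   side of the equity equation thus depends on the equities only through the
   payments they induce, so an equity solution is recovered from its payments
   as assets minus liabilities, and a clearing vector from the equities so
   defined.  Clipping at [0] is inactive on solutions, since assets are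
   nonnegative. *)

Require Import Defs.
From HB Require Import structures.
From mathcomp Require Import all_boot all_order all_algebra.
From mathcomp Require Import all_classical all_reals.

Set Implicit Arguments.
Unset Strict Implicit.
Unset Printing Implicit Defensive.

Import Order.TTheory GRing.Theory Num.Theory.

Local Open Scope classical_set_scope.
Local Open Scope ring_scope.

Definition payment (R : realType) (pbar x : R) : R :=
  Num.min (Num.max 0 (x + pbar)) pbar.

Definition payments (R : realType) (n : nat)
    (Le : 'rV[R]_n) (L : 'M[R]_n) (E : 'rV[R]_n) : 'rV[R]_n :=
  \row_j payment (total_liability Le L j) (E 0 j).

(** Convertible to the first argument of the minimum in [clearing_vectors]. *)
Definition asset_value (R : realType) (n : nat)
    (Ae Le : 'rV[R]_n) (L : 'M[R]_n) (p : 'rV[R]_n) (i : 'I_n) : R :=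
  Ae 0 i + \sum_(j < n) L j i * (p 0 j / total_liability Le L j).

Definition induced_equity (R : realType) (n : nat)
    (Ae Le : 'rV[R]_n) (L : 'M[R]_n) (p : 'rV[R]_n) : 'rV[R]_n :=
  \row_i (asset_value Ae Le L p i - total_liability Le L i).

Lemma pos_partE (R : realType) (x : R) : pos_part x = Num.max 0 x.
Proof.
by rewrite /pos_part maxr_absE add0r sub0r normrN.
Qed.

(** For [0 <= x] both sides are [1]. For [x < 0] the cap at [pbar] is inactive, and division by
    [pbar > 0] commutes with the maximum. At [pbar = 0] and [0 <= x] the sides would be [1] and
    [0]. *)
Lemma en_valuationE (R : realType) (pbar x : R) : 0 < pbar ->
  en_valuation pbar x = payment pbar x / pbar.
Proof.
move=> pbar_gt0; rewrite /en_valuation /payment pos_partE.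
have [x_ge0|x_lt0] := leP 0 x.
  have pbar_le : pbar <= x + pbar by rewrite lerDr.
  rewrite mulr0 addr0 (max_idPr (le_trans (ltW pbar_gt0) pbar_le)).
  by rewrite (min_idPr pbar_le) divff ?gt_eqF.
have le_pbar : Num.max 0 (x + pbar) <= pbar.
  by rewrite ge_max (ltW pbar_gt0) gerDr ltW.
rewrite add0r mulr1 (min_idPl le_pbar) maxr_pMl ?invr_ge0 ?ltW //.
by rewrite mul0r.
Qed.

Lemma payment_itv (R : realType) (pbar x : R) : 0 <= pbar ->
  0 <= payment pbar x <= pbar.
Proof.
by move=> pbar_ge0; rewrite /payment le_min le_max ge_min !lexx pbar_ge0 orbT.
Qed.

Lemma total_liability_ge0 (R : realType) (n : nat)
    (Le : 'rV[R]_n) (L : 'M[R]_n) (j : 'I_n) :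
  0 <= Le 0 j -> (forall i, 0 <= L j i) -> 0 <= total_liability Le L j.
Proof.
by move=> Le_ge0 L_ge0; rewrite addr_ge0 ?sumr_ge0.
Qed.

Lemma le_total_liability (R : realType) (n : nat)
    (Le : 'rV[R]_n) (L : 'M[R]_n) (i j : 'I_n) :
  0 <= Le 0 j -> (forall k, 0 <= L j k) -> L j i <= total_liability Le L j.
Proof.
move=> Le_ge0 L_ge0; rewrite /total_liability (bigD1 i) //= addrCA lerDl.
by rewrite addr_ge0 ?sumr_ge0.
Qed.

Lemma asset_value_ge0 (R : realType) (n : nat)
    (Ae Le : 'rV[R]_n) (L : 'M[R]_n) (p : 'rV[R]_n) (i : 'I_n) :
  (forall i, 0 <= Ae 0 i) -> (forall i, 0 <= Le 0 i) ->
  (forall i j, 0 <= L i j) -> (forall i, 0 <= p 0 i) ->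
  0 <= asset_value Ae Le L p i.
Proof.
move=> Ae_ge0 Le_ge0 L_ge0 p_ge0; rewrite addr_ge0 ?sumr_ge0 // => j _.
by rewrite mulr_ge0 ?divr_ge0 ?total_liability_ge0.
Qed.

(** Adding the total liability back to the induced equity leaves the asset value, on which clipping
    at [0] does nothing. What remains is the Eisenberg-Noe map at [p]. *)
Lemma payments_induced_equity (R : realType) (n : nat)
    (Ae Le : 'rV[R]_n) (L : 'M[R]_n) (p : 'rV[R]_n) (i : 'I_n) :
  0 <= asset_value Ae Le L p i ->
  payments Le L (induced_equity Ae Le L p) 0 i =
  Num.min (asset_value Ae Le L p i) (total_liability Le L i).
Proof.
by move=> a_ge0; rewrite !mxE /payment subrK (max_idPr a_ge0).
Qed.

Lemma equity_solutionsE (R : realType) (n : nat)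
    (Ae Le : 'rV[R]_n) (A L : 'M[R]_n)
    (Ve : 'I_n -> R -> R) (V : 'I_n -> 'I_n -> R -> R) (E : 'rV[R]_n) :
  (forall i, 0 <= Le 0 i) -> (forall i j, 0 <= L i j) ->
  (forall i j, A j i = L i j) -> (forall i x, Ve i x = 1) ->
  (forall i j x, V i j x = en_valuation (total_liability Le L j) x) ->
  equity_solutions Ae Le A L Ve V E <->
  induced_equity Ae Le L (payments Le L E) = E.
Proof.
move=> Le_ge0 L_ge0 A_L Ve_1 V_en.
have asset i j :
    A i j * V i j (E 0 j) =
    L j i * (payments Le L E 0 j / total_liability Le L j).
  have := total_liability_ge0 (Le_ge0 j) (L_ge0 j).
  rewrite A_L V_en mxE le_eqVlt => /predU1P[pbar0|/en_valuationE-> //].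
  (* For [pbar = 0] the two valuations may differ, but their common coefficient lies between [0] and
     the total liability of [j], so it vanishes. *)
  suff -> : L j i = 0 by rewrite !mul0r.
  by apply/le_anti; rewrite L_ge0 pbar0 le_total_liability.
have rhs i :
    Ae 0 i * Ve i (E 0 i) - Le 0 i + \sum_(j < n) A i j * V i j (E 0 j)
      - \sum_(j < n) L i j =
    induced_equity Ae Le L (payments Le L E) 0 i.
  rewrite Ve_1 mulr1 (eq_bigr _ (fun j _ => asset i j)) [RHS]mxE.
  by rewrite /asset_value /total_liability opprD addrA (addrAC (Ae 0 i)).
split=> [solE|fixE i]; last by rewrite rhs fixE.
by apply/rowP => i; rewrite -rhs -solE.
Qed.

Theorem proposition4p1 (R : realType) (n : nat)
    (Ae Le : 'rV[R]_n) (A L : 'M[R]_n)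
    (Ve : 'I_n -> R -> R) (V : 'I_n -> 'I_n -> R -> R)
    (Ae_ge0 : forall i : 'I_n, 0 <= Ae 0 i)
    (Le_ge0 : forall i : 'I_n, 0 <= Le 0 i)
    (L_ge0 : forall i j : 'I_n, 0 <= L i j)
    (A_L : forall i j : 'I_n, A j i = L i j)
    (Ve_1 : forall (i : 'I_n) (x : R), Ve i x = 1)
    (V_en : forall (i j : 'I_n) (x : R),
       V i j x = en_valuation (total_liability Le L j) x) :
  exists f : 'rV[R]_n -> 'rV[R]_n,
    set_bij (equity_solutions Ae Le A L Ve V) (clearing_vectors Ae Le L) f.
Proof.
have solP E := equity_solutionsE Ae E Le_ge0 L_ge0 A_L Ve_1 V_en.
have pbar_ge0 i := total_liability_ge0 (Le_ge0 i) (L_ge0 i).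
have payments_itv E i : 0 <= payments Le L E 0 i <= total_liability Le L i.
  by rewrite mxE payment_itv.
exists (payments Le L).
split=> [E /solP fixE|E E' /set_mem/solP fixE|p [p_itv p_clear]].
(* Only the left-hand [E] is unfolded through the fixed-point equation, which turns that side into
   the Eisenberg-Noe map at the payments of [E]. *)
- split=> // i; rewrite -{1}fixE payments_induced_equity //.
  by apply: asset_value_ge0 => // j; case/andP: (payments_itv E j).
- by move=> /set_mem/solP fixE' eq_pay; rewrite -fixE -fixE' eq_pay.
(* Surjectivity: the lower bound of the box makes the asset values nonnegative, so the clearing
   equations say exactly that the induced equity pays [p]. *)
have payK : payments Le L (induced_equity Ae Le L p) = p.
  apply/rowP => i; rewrite payments_induced_equity -?p_clear //.
  by apply: asset_value_ge0 => // j; case/andP: (p_itv j).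
by exists (induced_equity Ae Le L p); first by apply/solP; rewrite payK.
Qed.
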